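(* Let $d\ge3$, $T\subset\mathbb R$ with $|T|=n\ge d+1$, and let $P_\sigma(T)$ be a Veronese $d$-polytope whose signed $\sigma$-decomposition partitions $T$ into $d+1$ intervals $T=I_1\cup\dots\cup I_{d+1}$. If $|I_j|\ge2$ for all $j\in[d+1]$, then $P_\sigma(T)$ is combinatorially equivalent to the $d$-dimensional cross-polytope.
   Context: $\nu_d(t)=(1,t,\dots,t^d)$, $q_\xi(t)=\sum_{i=0}^d\xi_it^i$. A chamber $\sigma$ is the closure of a connected component of the complement in $\mathbb R^{d+1}$ of the hyperplanes $\{\xi:q_\xi(t)=0\}$, $t\in T$; $P_\sigma(T)=\mathrm{conv}\{\nu_d(t)/q_\xi(t):t\in T\}$ for any $\xi$ in the interior of $\sigma$ (combinatorial type independent of this choice). The signed $\sigma$-decomposition partitions $T$ into the maximal runs $I_1<I_2<\dots$ of consecutive elements of $T$ on which $\mathrm{sgn}\,q_\xi$ is constant. The $d$-dimensional cross-polytope is $\mathrm{conv}\{\pm e_1,\dots,\pm e_d\}\subset\mathbb R^d$. *)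

(* Defs.v *)
From mathcomp Require Import all_boot all_order all_algebra finmap.
From mathcomp Require Import all_classical all_reals all_analysis.

Set Implicit Arguments.
Unset Strict Implicit.
Unset Printing Implicit Defensive.

Import Order.TTheory GRing.Theory Num.Theory.
Import numFieldNormedType.Exports.

Local Open Scope classical_set_scope.
Local Open Scope ring_scope.

Definition convex_hull (R : realType) (m : nat) (A : set 'rV[R]_m) : set 'rV[R]_m :=
  smallest (@convex_set R 'rV[R]_m) A.

(* F is cut out of P by a linear inequality valid on P.  The zero functional is
   allowed, so that P itself and the empty set are faces, as is usual for the
   face lattice. *)
Definition is_face (R : realType) (m : nat) (P F : set 'rV[R]_m) : Prop :=
  exists (c : 'cV[R]_m) (b : R),
    (forall x, P x -> (x *m c) 0 0 <= b) /\
    F = [set x | P x /\ (x *m c) 0 0 = b].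

(* Isomorphism of the face lattices, ordered by inclusion.  The two ambient
   spaces may have different dimensions. *)
Definition combinatorially_equivalent (R : realType) (m k : nat)
    (P : set 'rV[R]_m) (Q : set 'rV[R]_k) : Prop :=
  exists phi : set 'rV[R]_m -> set 'rV[R]_k,
    set_bij (is_face P) (is_face Q) phi /\
    (forall F G, is_face P F -> is_face P G ->
       (F `<=` G <-> phi F `<=` phi G)).

Definition cross_polytope (R : realType) (d : nat) : set 'rV[R]_d :=
  convex_hull [set x | exists i : 'I_d, x = delta_mx 0 i \/ x = - delta_mx 0 i].
Arguments cross_polytope : clear implicits.

Definition veronese (R : realType) (d : nat) (t : R) : 'rV[R]_d.+1 :=
  \row_(i < d.+1) t ^+ i.

Definition qform (R : realType) (d : nat) (xi : 'rV[R]_d.+1) (t : R) : R :=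
  \sum_(i < d.+1) xi 0 i * t ^+ i.

Definition arrangement_complement (R : realType) (d : nat) (T : {fset R}) :
    set 'rV[R]_d.+1 :=
  [set xi | forall t, t \in T -> qform xi t != 0].

Definition is_chamber (R : realType) (d : nat) (T : {fset R})
    (sigma : set 'rV[R]_d.+1) : Prop :=
  exists2 xi, arrangement_complement T xi &
    sigma = closure (connected_component (arrangement_complement T) xi).

(* The representative of P_sigma(T) given by a vector xi interior to sigma. *)
Definition veronese_polytope (R : realType) (d : nat) (T : {fset R})
    (xi : 'rV[R]_d.+1) : set 'rV[R]_d.+1 :=
  convex_hull [set x | exists2 t, t \in T & x = (qform xi t)^-1 *: veronese d t].

Definition is_sign_run (R : realType) (d : nat) (T : {fset R})
    (xi : 'rV[R]_d.+1) (J : {fset R}) : Prop :=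
  [/\ J != fset0, {subset J <= T},
      (forall s t u, s \in J -> u \in J -> t \in T -> s <= t <= u -> t \in J) &
      (forall s t, s \in J -> t \in J ->
         Num.sg (qform xi s) = Num.sg (qform xi t))].

Definition is_maximal_sign_run (R : realType) (d : nat) (T : {fset R})
    (xi : 'rV[R]_d.+1) (J : {fset R}) : Prop :=
  is_sign_run T xi J /\
  (forall K, is_sign_run T xi K -> {subset J <= K} -> K = J).

(* The family I lists all the maximal runs, in increasing order. *)
Definition is_signed_decomposition (R : realType) (d : nat) (T : {fset R})
    (sigma : set 'rV[R]_d.+1) (k : nat) (I : 'I_k -> {fset R}) : Prop :=
  exists2 xi, interior sigma xi &
    (forall J, is_maximal_sign_run T xi J <-> exists j, I j = J) /\
    (forall i j : 'I_k, (i < j)%N ->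
       forall s t, s \in I i -> t \in I j -> s < t).

(* Main.v *)
(* A linear inequality valid on P_sigma(T) is a polynomial f of degree at most d
   with f / q_xi >= 0 on T; the corresponding face is spanned by the points of T
   where f vanishes.  Such an f changes sign weakly along I_1 < ... < I_{d+1}.
   If f has degree at most m and alternates weakly at m + 1 points, then f = 0:
   all the terms of the divided difference have the same sign, and their sum
   vanishes.  Dividing out one or two roots of f, this shows that a nonzero f
   vanishes only at the 2d inner endpoints max I_j, min I_{j+1}, and at most at
   one point of each of these d pairs.  Conversely prod_j (t - r_j), with r_j in
   [max I_j, min I_{j+1}], realises every such choice.  Hence the proper faces
   are the sets of vertices containing none of d disjoint pairs, as for the
   cross-polytope. *)
Require Import Defs.
From mathcomp Require Import all_boot all_order all_algebra finmap.
From mathcomp Require Import all_classical all_reals all_analysis.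
From mathcomp Require Import ring lra zify.
Import numFieldNormedType.Exports.
Import Order.TTheory GRing.Theory Num.Theory.

Set Implicit Arguments.
Unset Strict Implicit.
Unset Printing Implicit Defensive.

Local Open Scope classical_set_scope.
Local Open Scope ring_scope.

(** * Polynomials with weakly alternating values *)

Lemma sign_prod_switch (R : realDomainType) (n k : nat) (F : nat -> R) :
  (k <= n)%N ->
  (forall i, (i < k)%N -> 0 <= F i) ->
  (forall i, (k <= i < n)%N -> F i <= 0) ->
  0 <= (-1) ^+ (n - k) * \prod_(i < n) F i.
Proof.
elim: n => [|n IHn] le_kn Fge Fle.
  by rewrite big_ord0 mulr1 sub0n expr0 ler01.
rewrite big_ord_recr /=.
have [le_kn'|lt_nk] := leqP k n.
  have -> : (n.+1 - k = (n - k).+1)%N by lia.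
  rewrite exprS mulN1r mulNr mulrA -mulrN mulr_ge0 //.
    by apply: IHn => // i /andP[h1 h2]; apply: Fle; rewrite h1 ltnW.
  by rewrite oppr_ge0 Fle // le_kn' ltnSn.
have -> : k = n.+1 by lia.
rewrite subnn expr0 mul1r; apply: mulr_ge0; last by apply: Fge.
by apply: prodr_ge0 => i _; apply: Fge; have := ltn_ord i; lia.
Qed.

(** The coefficient of degree [m] in the Lagrange form of [f] at [c 0, ..., c m] is the sum of the
    [f.[c i] / W i], and it is 0 by the size bound. Since [W i] has sign [(-1) ^+ (m - i)], all
    terms have one sign, so each vanishes and [f] is 0 at every node. *)
Lemma alternating_poly_eq0 (R : realFieldType) (m : nat) (c : nat -> R)
    (f : {poly R}) :
  (size f <= m)%N ->
  (forall i j, (i < j <= m)%N -> c i < c j) ->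
  (forall i, (i <= m)%N -> 0 <= (-1) ^+ i * f.[c i]) ->
  f = 0.
Proof.
move=> size_f c_incr f_alt.
have c_neq (i j : 'I_m.+1) : i != j -> c i != c j.
  rewrite -val_eqE neq_ltn => /orP[] lt_ij.
    by rewrite lt_eqF // c_incr // lt_ij -ltnS ltn_ord.
  by rewrite gt_eqF // c_incr // lt_ij -ltnS ltn_ord.
pose W (i : 'I_m.+1) := \prod_(k < m.+1 | k != i) (c i - c k).
(* [l i / W i] are the Lagrange basis polynomials at the points [c i]. *)
pose l (i : 'I_m.+1) : {poly R} := \prod_(k < m.+1 | k != i) ('X - (c k)%:P).
have W_neq0 i : W i != 0.
  by apply/prodf_neq0 => k neq_ki; rewrite subr_eq0 eq_sym c_neq.
have size_l i : size (l i) = m.+1.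
  rewrite /l -big_filter size_prod_XsubC -sum1_size big_filter.
  by rewrite sum1_card cardC1 card_ord.
have l_monic i : l i \is monic by apply: monic_prod_XsubC.
have l_eval (i j : 'I_m.+1) : (l i).[c j] = if i == j then W i else 0.
  case: eqVneq => [<-|neq_ij].
    by rewrite /l horner_prod; apply: eq_bigr => k _; rewrite hornerXsubC.
  rewrite /l horner_prod (bigD1 j) 1?eq_sym //= hornerXsubC subrr.
  by rewrite mul0r.
have f_lagrange : f = \sum_(i < m.+1) (f.[c i] / W i) *: l i.
  (* A nonzero difference would have [m.+1] distinct roots but size at most [m.+1]. *)
  apply/eqP; rewrite -subr_eq0; apply/negP => /negP nz.
  have /(_ [seq c (val i) | i <- enum 'I_m.+1]) := max_poly_roots nz.
  have -> : all (root (f - \sum_(i < m.+1) (f.[c i] / W i) *: l i))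
      [seq c (val i) | i <- enum 'I_m.+1].
    apply/allP => _ /mapP[j _ ->]; apply/rootP.
    rewrite hornerD hornerN horner_sum (bigD1 j) //= big1 => [|i neq_ij].
      by rewrite hornerZ l_eval eqxx divfK // addr0 subrr.
    by rewrite hornerZ l_eval (negbTE neq_ij) mulr0.
  rewrite map_inj_uniq ?enum_uniq => [|i j eq_c]; last first.
    by apply/eqP; apply: contraT => /c_neq; rewrite eq_c eqxx.
  rewrite size_map -cardE card_ord => /(_ isT isT).
  rewrite ltnNge => /negP; apply.
  apply: leq_trans (size_polyD _ _) _; rewrite geq_max size_polyN.
  rewrite leqW //=; apply: leq_trans (size_sum _ _ _) _.
  apply/bigmax_leqP => i _; apply: leq_trans (size_scale_leq _ _) _.
  by rewrite size_l.
(* The coefficient of degree [m] in the interpolation formula vanishes. *)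
have sum0 : \sum_(i < m.+1) (-1) ^+ m * (f.[c i] / W i) = 0.
  rewrite -mulr_sumr; have /(congr1 (fun p : {poly R} => p`_m)) := f_lagrange.
  rewrite nth_default // coef_sum => eq0.
  rewrite (_ : \sum_i _ = 0) ?mulr0 // [RHS]eq0; apply: eq_bigr => i _.
  have := l_monic i; rewrite monicE lead_coefE size_l /= coefZ => /eqP ->.
  by rewrite mulr1.
have W_sign (i : 'I_m.+1) : 0 < (-1) ^+ (m - i) * W i.
  rewrite lt_neqAle eq_sym mulf_neq0 ?signr_eq0 //=.
  (* The omitted factor is replaced by 1 and counted among the nonnegative ones, so exactly the
     [m - i] indices above [i] give negative factors. *)
  have := @sign_prod_switch R m.+1 i.+1 
    (fun k => if k == i then 1 else c i - c k) (ltn_ord i).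
  rewrite subSS /W (bigD1 i) //= eqxx mul1r => H.
  suff -> : \prod_(k < m.+1 | k != i) (c i - c k) =
     \prod_(k < m.+1 | k != i) (if (k : nat) == i then 1 else c i - c k).
    apply: H => [k|k /andP[lt_ik lt_k]].
      rewrite ltnS; case: eqVneq => // neq_ki le_ki; rewrite subr_ge0 ltW //.
      by apply: c_incr; have := ltn_ord i; lia.
    rewrite gtn_eqF // subr_le0 ltW //.
    by apply: c_incr; lia.
  by apply: eq_bigr => k; rewrite -val_eqE /= => /negbTE ->.
have term_ge0 (i : 'I_m.+1) : 0 <= (-1) ^+ m * (f.[c i] / W i).
  have le_im : (i <= m)%N by rewrite -ltnS.
  (* Multiplying by the positive number [(-1) ^+ (m - i) * W i] clears the denominator; the
     exponents add up to the parity of [i]. *)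
  rewrite -(pmulr_lge0 _ (W_sign i)).
  have -> : (-1) ^+ m * (f.[c i] / W i) * ((-1) ^+ (m - i) * W i)
     = (-1) ^+ (m + (m - i)) * f.[c i].
    by rewrite exprD mulrACA divfK.
  have -> : ((-1) ^+ (m + (m - i)) : R) = (-1) ^+ i.
    rewrite -[LHS]signr_odd -[RHS]signr_odd oddD oddB //.
    by rewrite addbA addbb.
  exact: f_alt.
have term0 (i : 'I_m.+1) : f.[c i] / W i = 0.
  have /eqP := sum0; rewrite psumr_eq0 // => /allP /(_ i).
  rewrite mem_index_enum => /(_ isT) /= /eqP.
  by move/eqP; rewrite mulf_eq0 signr_eq0 => /eqP.
by rewrite f_lagrange big1 // => i _; rewrite term0 scale0r.
Qed.

(** * Zeros of a polynomial whose sign alternates along the runs *)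

Lemma pmul_sign_ge0 (R : realDomainType) (s x y : R) :
  0 < x -> 0 <= s * (y * x) -> 0 <= s * y.
Proof. by move=> x0; rewrite mulrA pmulr_lge0. Qed.

Section ZerosOnRuns.
Variables (R : realFieldType) (d : nat) (J : nat -> {fset R}) (a b : nat -> R).
Hypothesis J_incr : forall i j s t,
  (i < j <= d)%N -> s \in J i -> t \in J j -> s < t.
Hypothesis aJ : forall i, (i <= d)%N -> a i \in J i.
Hypothesis bJ : forall i, (i <= d)%N -> b i \in J i.
Hypothesis lt_ab : forall i, (i <= d)%N -> a i < b i.
Hypothesis J_range : forall i t, (i <= d)%N -> t \in J i -> a i <= t <= b i.

Variable f : {poly R}.
Hypothesis f_neq0 : f != 0.
Hypothesis size_f : (size f <= d.+1)%N.
Hypothesis f_sign : forall i t,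
  (i <= d)%N -> t \in J i -> 0 <= (-1) ^+ i * f.[t].

(** Otherwise the quotient of [f] by ['X - z], of size at most [d], alternates weakly at [d + 1]
    points up to a global sign, and so vanishes. *)
Lemma root_in_run_endpoint j z : (j <= d)%N -> z \in J j -> root f z ->
  (z = b j /\ (j < d)%N) \/ (z = a j /\ (0 < j)%N).
Proof.
move=> le_jd zJ /factor_theorem[g f_def].
have g_neq0 : g != 0 by apply: contraNneq f_neq0 => g0; rewrite f_def g0 mul0r.
have size_g : (size g <= d)%N.
  by move: size_f; rewrite f_def size_Mmonic ?monicXsubC // size_XsubC addn2.
have f_eval t : f.[t] = g.[t] * (t - z).
  by rewrite f_def hornerM hornerXsubC.
have [le_az le_zb] := andP (J_range le_jd zJ).
have [eq_az|neq_az] := eqVneq z (a j).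
  have [j0|] := posnP j; last by right.
  exfalso; move/eqP: g_neq0; apply.
  (* Here [z = a 0] lies to the left of every [b i], so the quotient inherits the signs of [f]
     there. *)
  apply: (@alternating_poly_eq0 _ d b) => // [i k lt_ik|i le_id].
    by apply: (J_incr lt_ik); apply: bJ; lia.
  apply: (@pmul_sign_ge0 _ _ (b i - z)).
    rewrite subr_gt0; have [i0|i_gt0] := posnP i.
      by rewrite eq_az j0 i0 lt_ab.
    by apply: (@J_incr j i); rewrite ?bJ //; lia.
  by rewrite -f_eval f_sign // bJ.
have lt_az : a j < z by rewrite lt_neqAle eq_sym neq_az.
have [/andP[/eqP -> lt_jd]|not_b] := boolP ((z == b j) && (j < d)%N).
  by left.
(* [- g] alternates at the first [d + 1] of the points
   [b 0 < ... < b (j - 1) < a j < b j < b (j + 1) < ...], because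
   dividing by ['X - z] flips the signs to the left of [z] only. *)
exfalso; move: g_neq0; rewrite -oppr_eq0 => /eqP; apply.
pose c i := if (i < j)%N then b i else if i == j then a j else b i.-1.
(* When [j = d], the point [b d] is not among the first [d + 1], so [z = b d] is excluded as
   well. *)
have lt_zb : (j < d)%N -> z < b j.
  move=> lt_jd; rewrite lt_neqAle le_zb.
  by move: not_b; rewrite lt_jd andbT => ->.
apply: (@alternating_poly_eq0 _ d c); first by rewrite size_polyN.
  move=> i k lt_ik; rewrite /c.
  have [lt_ij|le_ji] := ltnP i j.
    have [lt_kj|le_jk] := ltnP k j.
      by apply: (J_incr lt_ik); apply: bJ; lia.
    have [eq_kj|neq_kj] := eqVneq k j.
      by apply: (@J_incr i j); rewrite ?aJ ?bJ //; lia.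
    by apply: (@J_incr i k.-1); rewrite ?bJ //; lia.
  have -> : (k < j)%N = false by lia.
  have -> : (k == j) = false by lia.
  have [eq_ij|neq_ij] := eqVneq i j; last first.
    by apply: (@J_incr i.-1 k.-1); rewrite ?bJ //; lia.
  have [->|neq_kj] := eqVneq k.-1 j; first by apply: lt_ab.
  by apply: (@J_incr j k.-1); rewrite ?aJ ?bJ //; lia.
move=> i le_id; rewrite hornerN.
have [lt_ij|le_ji] := ltnP i j.
  have -> : c i = b i by rewrite /c lt_ij.
  apply: (@pmul_sign_ge0 _ _ (z - b i)).
    by rewrite subr_gt0; apply: (@J_incr i j); rewrite ?bJ //; lia.
  by rewrite mulNr -mulrN opprB -f_eval f_sign // bJ.
have [->|neq_ij] := eqVneq i j.
  have -> : c j = a j by rewrite /c ltnn eqxx.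
  apply: (@pmul_sign_ge0 _ _ (z - a j)); first by rewrite subr_gt0.
  by rewrite mulNr -mulrN opprB -f_eval f_sign // aJ.
have -> : c i = b i.-1 by rewrite /c ltnNge le_ji (negbTE neq_ij).
have [i' i_def] : exists i', i = i'.+1 by exists i.-1; lia.
apply: (@pmul_sign_ge0 _ _ (b i.-1 - z)).
  rewrite subr_gt0; have [->|neq] := eqVneq i.-1 j; first by apply: lt_zb; lia.
  by apply: (@J_incr j i.-1); rewrite ?bJ //; lia.
rewrite mulNr mulrN -f_eval i_def exprS mulN1r mulNr opprK /=.
by rewrite f_sign ?bJ //; lia.
Qed.

(** The product [(t - b j) * (t - a j.+1)] is positive outside the closed gap between the two runs,
    so dividing it out preserves the alternation at points outside the gap. *)
Lemma adjacent_endpoints_not_roots j :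
  (j < d)%N -> root f (b j) -> root f (a j.+1) -> False.
Proof.
move=> lt_jd /factor_theorem[h f_def] root_a.
have lt_ba : b j < a j.+1 by apply: (@J_incr j j.+1); rewrite ?aJ ?bJ //; lia.
have /factor_theorem[g h_def] : root h (a j.+1).
  by move: root_a; rewrite f_def rootM root_XsubC gt_eqF // orbF.
move: f_def; rewrite {}h_def => f_def.
have g_neq0 : g != 0.
  by apply: contraNneq f_neq0 => g0; rewrite f_def g0 !mul0r.
have size_g : (size g <= d)%N.
  move: size_f; rewrite f_def !size_Mmonic ?monicXsubC //.
    by rewrite !size_XsubC !addn2 => /ltnW.
  by rewrite mulf_neq0 ?polyXsubC_eq0.
move/eqP: g_neq0; apply.
(* In each run, the end farther from the gap; [lt_ab] keeps [c j] and [c j.+1] strictly off the two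
   roots. *)
pose c i := if (i <= j)%N then a i else b i.
have cJ i : (i <= d)%N -> c i \in J i.
  by move=> le_id; rewrite /c; case: ifP; rewrite ?aJ ?bJ.
apply: (@alternating_poly_eq0 _ d c) => // [i k lt_ik|i le_id].
  by apply: (J_incr lt_ik); apply: cJ; lia.
apply: (@pmul_sign_ge0 _ _ ((c i - a j.+1) * (c i - b j))); last first.
  have := f_sign le_id (cJ _ le_id).
  by rewrite f_def !hornerM !hornerXsubC -!mulrA.
rewrite /c; case: leqP => [le_ij|lt_ji].
  have lt_ab' : a i < b j.
    move: le_ij; rewrite leq_eqVlt => /orP[/eqP ->|lt_ij].
      by apply: lt_ab; lia.
    by apply: (@J_incr i j); rewrite ?aJ ?bJ //; lia.
  by rewrite nmulr_rgt0 subr_lt0 // (lt_trans lt_ab').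
have lt_ab' : a j.+1 < b i.
  move: lt_ji; rewrite leq_eqVlt => /orP[/eqP <-|lt_ij].
    by apply: lt_ab; lia.
  by apply: (@J_incr j.+1 i); rewrite ?aJ ?bJ //; lia.
by rewrite mulr_gt0 // subr_gt0 // (lt_trans lt_ba).
Qed.

End ZerosOnRuns.

(** * Linear functionals on convex hulls *)

Lemma conv_mulmx (R : realType) (m : nat) (l : {i01 R}) (c : 'cV[R]_m)
    (x y : convex_lmodType 'rV[R]_m) :
  ((conv l x y : 'rV[R]_m) *m c) 0 0 =
  l%:num * (x *m c) 0 0 + (1 - l%:num) * (y *m c) 0 0.
Proof.
rewrite mulmxDl -!scalemxAl [LHS]mxE; congr (_ + _); by rewrite mxE.
Qed.

(** The bound together with the implication defines a convex set: a proper convex combination is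
    tight only if both of its points are. *)
Lemma hull_tight_sub (R : realType) (m : nat) (V : set 'rV[R]_m)
    (c c' : 'cV[R]_m) (b b' : R) :
  (forall x, V x -> (x *m c) 0 0 <= b) ->
  (forall x, V x -> (x *m c) 0 0 = b -> (x *m c') 0 0 = b') ->
  forall x, convex_hull V x -> (x *m c) 0 0 = b -> (x *m c') 0 0 = b'.
Proof.
move=> V_le V_tight x Vx; pose K : set 'rV[R]_m := [set y |
  (y *m c) 0 0 <= b /\ ((y *m c) 0 0 = b -> (y *m c') 0 0 = b')].
suff /(_ x Vx) [] : convex_hull V `<=` K by [].
apply: smallest_sub => [y z l|y Vy]; last first.
  by split; [exact: V_le|exact: V_tight].
rewrite !inE => -[y_le y_tight] [z_le z_tight].
have l_ge0 : 0 <= l%:num by [].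
have l_le1 : l%:num <= 1 by [].
rewrite /K /= !conv_mulmx; split; first by nra.
(* With weight 0 or 1 one of the two points need not be tight, so these cases are separate. *)
have [->|l_neq0] := eqVneq l%:num 0.
  by rewrite !mul0r !add0r subr0 !mul1r.
have [->|l_neq1] := eqVneq l%:num 1.
  by rewrite subrr !mul0r !addr0 !mul1r.
have l_gt0 : 0 < l%:num by rewrite lt_neqAle eq_sym l_neq0.
have l_lt1 : l%:num < 1 by rewrite lt_neqAle l_neq1.
move=> eq_b; have eq_y : (y *m c) 0 0 = b.
  by apply/eqP; rewrite eq_le y_le /=; nra.
have eq_z : (z *m c) 0 0 = b.
  by apply/eqP; rewrite eq_le z_le /=; nra.
by rewrite y_tight // z_tight //; lra.
Qed.

(** * Face lattices encoded by antipode-free sets *)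

(** The index [(i, true)] stands for the vertex [e_i] and [(i, false)] for its antipode; these sets
    are the simplices of the boundary complex of the cross-polytope, the empty one included. *)
Definition antipode_free (d : nat) (A : set ('I_d * bool)) :=
  forall i, ~ (A (i, true) /\ A (i, false)).

(* A proper face of [conv V] is encoded by the set of [a] with [v a] on it. *)
Definition cross_like (R : realType) (m d : nat) (V : set 'rV[R]_m)
    (v : 'I_d * bool -> 'rV[R]_m) : Prop :=
  [/\ forall a, V (v a),
      (forall (c : 'cV[R]_m) (b : R), (forall x, V x -> (x *m c) 0 0 <= b) ->
         (forall x, V x -> (x *m c) 0 0 = b) \/
         antipode_free [set a | (v a *m c) 0 0 = b] /\
         (forall x, V x -> (x *m c) 0 0 = b -> exists a, x = v a)) &
      (forall A, antipode_free A -> exists (c : 'cV[R]_m) (b : R),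
         (forall x, V x -> (x *m c) 0 0 <= b) /\
         [set a | (v a *m c) 0 0 = b] = A)].

Section CrossLike.
Variables (R : realType) (m d : nat) (V : set 'rV[R]_m).
Variable v : 'I_d * bool -> 'rV[R]_m.
Hypothesis V_cross : cross_like V v.
Let P := convex_hull V.

Let V_le_P (c : 'cV[R]_m) b : (forall x, P x -> (x *m c) 0 0 <= b) ->
  forall x, V x -> (x *m c) 0 0 <= b.
Proof. by move=> P_le x Vx; apply: P_le; apply: sub_gen_smallest. Qed.

Let P_le_V (c : 'cV[R]_m) b : (forall x, V x -> (x *m c) 0 0 <= b) ->
  forall x, P x -> (x *m c) 0 0 <= b.
Proof.
move=> V_le; apply: smallest_sub => // x y l.
rewrite !inE /= conv_mulmx => x_le y_le.
have : 0 <= l%:num by [].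
have : l%:num <= 1 by [].
by nra.
Qed.

Lemma face_trace F : is_face P F ->
  antipode_free (v @^-1` F) \/ v @^-1` F = setT.
Proof.
case: V_cross => vV V_dich _ [c [b [/V_le_P V_le ->]]].
have vP a : P (v a) by exact: sub_gen_smallest.
case: (V_dich c b V_le) => [all_tight|[free _]]; [right|left].
  by apply/seteqP; split => // a _; split; [exact: vP|exact: all_tight].
by move=> i [[_ h1] [_ h2]]; apply: (free i).
Qed.

Lemma trace_face A : antipode_free A \/ A = setT ->
  exists2 F, is_face P F & v @^-1` F = A.
Proof.
case: V_cross => vV _ V_real [/V_real[c [b [/P_le_V P_le <-]]]|->].
  exists [set x | P x /\ (x *m c) 0 0 = b]; first by exists c, b.
  apply/seteqP; split => [a []//|a tight]; split => //.
  exact: sub_gen_smallest.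
exists P; last first.
  by apply/seteqP; split => // a _; exact: sub_gen_smallest.
exists 0, 0; split => [x _|]; first by rewrite mulmx0 mxE.
by apply/seteqP; split => [x Px|x []//]; split => //; rewrite mulmx0 mxE.
Qed.

(** Tight generators of a face other than [P] are among the [v a], and [hull_tight_sub] extends
    tightness from generators to the hull. *)
Lemma face_sub_trace F G : (0 < d)%N -> is_face P F -> is_face P G ->
  (F `<=` G <-> v @^-1` F `<=` v @^-1` G).
Proof.
case: V_cross => vV V_dich _ d_gt0.
have vP a : P (v a) by exact: sub_gen_smallest.
move=> [c [b [/V_le_P V_le ->]]] [c' [b' [/V_le_P V_le' ->]]].
split=> [sub a /sub//|sub x [Px x_tight]]; split => //.
apply: (hull_tight_sub V_le _ Px x_tight) => y Vy y_tight.
case: (V_dich _ _ V_le) => [all_tight|[_ only]]; last first.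
  have [a y_def] := only y Vy y_tight; move: y_tight; rewrite y_def => tight.
  by have [] := sub a (conj (vP a) tight).
case: (V_dich _ _ V_le') => [->//|[free _]].
(* Here [F] is all of [P], so the trace of [G] contains every index; since [d > 0] it contains an
   antipodal pair. *)
exfalso; apply: (free (Ordinal d_gt0)).
have tight' a : (v a *m c') 0 0 = b'.
  by have [] := sub a (conj (vP a) (all_tight _ (vV a))).
by split; apply: tight'.
Qed.

End CrossLike.

(** Faces on both sides are classified, with their order, by the same family of traces; [phi]
    matches faces of equal trace. *)
Lemma cross_like_equivalent (R : realType) (m k d : nat)
    (V : set 'rV[R]_m) (W : set 'rV[R]_k) v w : (0 < d)%N ->
  @cross_like R m d V v -> @cross_like R k d W w ->
  combinatorially_equivalent (convex_hull V) (convex_hull W).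
Proof.
move=> d_gt0 V_cross W_cross.
have /choice[phi phiP] F : exists G, is_face (convex_hull V) F ->
    is_face (convex_hull W) G /\ w @^-1` G = v @^-1` F.
  (* Sets that are not faces receive the dummy value [set0]. *)
  have [faceF|notF] := pselect (is_face (convex_hull V) F); last by exists set0.
  have [G faceG trG] := trace_face W_cross (face_trace V_cross faceF).
  by exists G.
have phi_sub F G : is_face (convex_hull V) F -> is_face (convex_hull V) G ->
    (F `<=` G <-> phi F `<=` phi G).
  move=> faceF faceG.
  have [facephiF trF] := phiP _ faceF; have [facephiG trG] := phiP _ faceG.
  rewrite (face_sub_trace V_cross d_gt0 faceF faceG).
  by rewrite (face_sub_trace W_cross d_gt0 facephiF facephiG) trF trG.
exists phi; split => //; split.
- by move=> F /phiP[].
- move=> F G; rewrite !inE => faceF faceG eq_phi.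
  by apply/seteqP; split; apply/phi_sub => //; rewrite eq_phi.
- move=> G faceG.
  have [F faceF trF] := trace_face V_cross (face_trace W_cross faceG).
  exists F => //; have [facephiF trphi] := phiP _ faceF.
  by apply/seteqP; split; apply/(face_sub_trace W_cross d_gt0) => //;
    rewrite trphi trF.
Qed.

(** * The cross-polytope *)

Lemma cross_polytope_cross_like (R : realType) (d : nat) : (0 < d)%N ->
  cross_like
    [set x : 'rV[R]_d | exists i, x = delta_mx 0 i \/ x = - delta_mx 0 i]
    (fun a : 'I_d * bool => (-1) ^+ (~~ a.2) *: delta_mx 0 a.1).
Proof.
move=> d_gt0.
pose w (a : 'I_d * bool) : 'rV[R]_d := (-1) ^+ (~~ a.2) *: delta_mx 0 a.1.
have wE a (c : 'cV[R]_d) : (w a *m c) 0 0 = (-1) ^+ (~~ a.2) * c a.1 0.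
  by rewrite /w -scalemxAl mxE -rowE mxE.
have Vw x : (exists i, x = delta_mx 0 i \/ x = - delta_mx 0 i) <->
    exists a, x = w a.
  split=> [[i [->|->]]|[[i [] ->]]]; rewrite /w /=.
  - by exists (i, true); rewrite scale1r.
  - by exists (i, false); rewrite scaleN1r.
  - by exists i; rewrite scale1r; left.
  - by exists i; rewrite scaleN1r; right.
split; first by move=> a; apply/Vw; exists a.
- move=> c b V_le.
  have w_le a : (-1) ^+ (~~ a.2) * c a.1 0 <= b.
    by rewrite -wE; apply: V_le; apply/Vw; exists a.
  (* A functional takes opposite values at antipodes: if [b = 0] it must vanish, and if [b] is
     nonzero it cannot equal [b] at both. *)
  have [b0|b_neq0] := eqVneq b 0.
    left=> x /Vw[a ->]; rewrite wE.
    suff -> : c a.1 0 = 0 by rewrite mulr0.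
    move: (w_le (a.1, true)) (w_le (a.1, false)); rewrite b0 /= mul1r mulN1r.
    by move=> h1 h2; lra.
  right; split=> [i [/=]|x /Vw//].
  rewrite -/(w (i, true)) -/(w (i, false)) !wE /= mul1r mulN1r => h1 h2.
  by move/eqP: b_neq0; apply; lra.
- move=> A A_free.
  (* The coordinate is 1, -1 or 0 according to which vertex of the pair, if any, lies in [A]; the
     value 1 is then attained exactly on [A]. *)
  exists (\col_i ((`[< A (i, true) >])%:R - (`[< A (i, false) >])%:R)), 1.
  have tightP a : (-1) ^+ (~~ a.2) * ((`[< A (a.1, true) >])%:R
      - (`[< A (a.1, false) >])%:R) <= 1 :> R /\
    ((-1) ^+ (~~ a.2) * ((`[< A (a.1, true) >])%:R
      - (`[< A (a.1, false) >])%:R) = 1 :> R <-> A a).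
    case: a => i s; have /= := A_free i.
    case: (asboolP (A (i, true))); case: (asboolP (A (i, false))) => h1 h2 h;
      case: s; rewrite /= ?expr0 ?expr1; split; try split=> //; try lra;
      by move=> ?; exfalso; first [lra|tauto].
  split=> [x /Vw[a ->]|]; first by rewrite wE mxE; case: (tightP a).
  by apply/seteqP; split => a /=; rewrite -/(w a) wE mxE;
    case: (tightP a) => _ [].
Qed.

(** * Constancy of signs on a chamber *)

Lemma qformB_scale (R : realType) (d : nat) (x y : 'rV[R]_d.+1) (e t : R) :
  qform (x - e *: y) t = qform x t - e * qform y t.
Proof.
rewrite /qform mulr_sumr -sumrB; apply: eq_bigr => i _.
by rewrite !mxE mulrBl mulrA.
Qed.

Lemma qform_continuous (R : realType) (d : nat) (t : R) :
  continuous (fun x : 'rV[R]_d.+1 => qform x t).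
Proof.
apply: continuous_big => [|i _ x]; first exact: add_continuous.
apply: (@cvgM R _ (nbhs x) _ (fun y : 'rV[R]_d.+1 => y 0 i) (fun=> t ^+ i)
  (x 0 i) (t ^+ i)); last exact: cvg_cst.
exact: (@coord_continuous R 1 d.+1 0 i x).
Qed.

(** The sign at [t] is compared with that of the base point [xi]: strict on the component, weak on
    its closure, and strict again in the interior of the closure. *)
Lemma chamber_sign (R : realType) (d : nat) (T : {fset R})
    (sigma : set 'rV[R]_d.+1) x y t :
  is_chamber T sigma -> interior sigma x -> interior sigma y -> t \in T ->
  0 < qform x t * qform y t.
Proof.
move=> [xi xi_compl ->] int_x int_y tT.
set C := connected_component _ _ in int_x int_y.
have q_neq0 := xi_compl t tT.
have C_sign z : C z -> 0 < qform z t * qform xi t.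
  have C_itv : is_interval [set qform z t | z in C].
    apply/connected_intervalP/connected_continuous_connected.
      exact: component_connected.
    by apply: continuous_subspaceT; exact: qform_continuous.
  move=> Cz; have zT := connected_component_sub Cz.
  have qz_neq0 := zT t tT.
  rewrite lt_neqAle eq_sym mulf_neq0 //= leNgt; apply/negP => lt0.
  have Cxi : C xi by exact: connected_component_refl.
  (* Opposite signs would force the value 0 inside the component, by connectedness. *)
  have [w /connected_component_sub /(_ t tT) /eqP] : [set qform z t | z in C] 0.
    have [lt_z|lt_z|eq_z] := ltgtP (qform z t) 0.
    - apply: (C_itv (qform z t) (qform xi t)); [by exists z|by exists xi|].
      by move: lt0; rewrite nmulr_rlt0 // => lt_xi; rewrite !ltW.
    - apply: (C_itv (qform xi t) (qform z t)); [by exists xi|by exists z|].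
      by move: lt0; rewrite pmulr_rlt0 // => lt_xi; rewrite !ltW.
    - by move: qz_neq0; rewrite eq_z eqxx.
  by [].
have cl_sign z : closure C z -> 0 <= qform z t * qform xi t.
  have cl : closed [set z : 'rV[R]_d.+1 | 0 <= qform z t * qform xi t].
    apply: (@preimage_closed _ _ (fun z : 'rV[R]_d.+1 => qform z t * qform xi t)
      [set r | 0 <= r]); last exact: closed_ge.
    move=> u _; apply: (@cvgM R _ (nbhs u) _ (fun w => qform w t)
      (fun=> qform xi t) (qform u t)); last exact: cvg_cst.
    exact: qform_continuous.
  move=> clz; change ([set z : 'rV[R]_d.+1 | 0 <= qform z t * qform xi t] z).
  rewrite ((closure_id _).1 cl); apply: closure_subset clz => w Cw.
  exact/ltW/C_sign.
have int_sign z : interior (closure C) z -> 0 < qform z t * qform xi t.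
  move=> int_z.
  (* A small move from [z] in the direction [- xi] stays in the closure, so the weak inequality
     there leaves a positive margin at [z]. *)
  have /nbhs_ballP[e /= e0 ball_sub] :
      nbhs (0 : R) [set r | closure C (z - r *: xi)].
    have : continuous (fun r : R => z - r *: xi).
      move=> r; apply: cvgB; first exact: cvg_cst.
      by apply: cvgZ; [exact: cvg_id|exact: cvg_cst].
    move/(_ 0); rewrite /continuous_at scale0r subr0; exact.
  have /ball_sub /cl_sign : ball (0 : R) e (e / 2).
    rewrite /ball /= sub0r normrN gtr0_norm ?divr_gt0 //.
    by rewrite ltr_pdivrMr // mulr_natr mulr2n ltrDl.
  rewrite qformB_scale mulrBl -mulrA => ge0.
  have : 0 < e / 2 * (qform xi t * qform xi t).
    by rewrite mulr_gt0 ?divr_gt0 // -expr2 exprn_even_gt0.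
  by lra.
have := mulr_gt0 (int_sign _ int_x) (int_sign _ int_y).
rewrite mulrACA -expr2 pmulr_lgt0 // exprn_even_gt0 //.
Qed.

(** * Maximal sign runs and their endpoints *)

Section SignRuns.
Variables (R : realType) (d : nat) (T : {fset R}) (xi : 'rV[R]_d.+1).
Let sgq t := Num.sg (qform xi t).

(** The run through [t] collects the [u] such that all of [T] between [t] and [u], on either side,
    has the sign of [t]. Any run containing it is convex in [T] and contains [t], hence adds
    nothing. *)
Lemma mem_maximal_sign_run t : t \in T ->
  exists2 J, is_maximal_sign_run T xi J & t \in J.
Proof.
move=> tT; pose P u := `[< forall w, w \in T ->
  t <= w <= u \/ u <= w <= t -> sgq w = sgq t >].
pose J := [fset u in T | P u]%fset.
have JP u : u \in T ->
    (forall w, w \in T -> t <= w <= u \/ u <= w <= t -> sgq w = sgq t) ->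
    u \in J.
  by move=> uT Pu; rewrite !inE /= uT; apply/asboolP.
have PJ u : u \in J -> u \in T /\
    (forall w, w \in T -> t <= w <= u \/ u <= w <= t -> sgq w = sgq t).
  by rewrite !inE /= => /andP[uT /asboolP].
have tJ : t \in J.
  by apply: JP => // w _ [] /andP[h1 h2]; congr sgq; apply/le_anti/andP.
exists J => //; split; [split|].
- by apply/fset0Pn; exists t.
- by move=> u /PJ[].
- move=> s v u /PJ[_ Ps] /PJ[_ Pu] vT /andP[le_sv le_vu]; apply: JP => // w wT.
  case=> /andP[h1 h2]; [apply: Pu|apply: Ps] => //.
    by left; rewrite h1 (le_trans h2).
  by right; rewrite h2 (le_trans le_sv).
- move=> s u /PJ[sT Ps] /PJ[uT Pu]; rewrite -/(sgq s) -/(sgq u).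
  have Pself v : v \in T -> (forall w, w \in T ->
      t <= w <= v \/ v <= w <= t -> sgq w = sgq t) -> sgq v = sgq t.
    move=> vT Pv; apply: Pv => //.
    by case: (leP t v) => [le_tv|/ltW le_vt]; [left|right];
      rewrite lexx ?le_tv ?le_vt.
  by rewrite (Pself s) // (Pself u).
- move=> K [K_neq0 KT K_conv K_sign] JK.
  apply/fsetP => u; apply/idP/idP; last exact: JK.
  move=> uK; apply: JP => [|w wT bet]; first exact: KT.
  apply: K_sign; last exact: JK.
  by case: bet => bet; [apply: (K_conv t w u)|apply: (K_conv u w t)] => //;
    exact: JK.
Qed.

Variable I : 'I_d.+1 -> {fset R}.
Hypothesis I_runs : forall J, is_maximal_sign_run T xi J <-> exists j, I j = J.
Hypothesis I_incr : forall i j : 'I_d.+1, (i < j)%N ->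
  forall s t, s \in I i -> t \in I j -> s < t.

Let I_max j : is_maximal_sign_run T xi (I j).
Proof. by apply/I_runs; exists j. Qed.

Lemma sign_runs_cover t : t \in T -> exists j, t \in I j.
Proof.
by move=> /mem_maximal_sign_run[J /I_runs[j <-] tJ]; exists j.
Qed.

(** With equal signs, the union of the two adjacent runs would be a run, against the maximality of
    [I i]. *)
Lemma sign_runs_switch (i j : 'I_d.+1) s t : j = i.+1 :> nat ->
  s \in I i -> t \in I j -> sgq s != sgq t.
Proof.
move=> ji sI tI; apply/eqP => eq_st.
have [[_ iT i_conv i_sign] i_max] := I_max i.
have [[_ jT j_conv j_sign] _] := I_max j.
have sign_s u : u \in (I i `|` I j)%fset -> sgq u = sgq s.
  rewrite in_fsetU => /orP[uI|uI]; first exact: i_sign.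
  by rewrite eq_st; apply: j_sign.
suff /(i_max _) eq_ij : is_sign_run T xi (I i `|` I j)%fset.
  have : t \in I i.
    by rewrite -eq_ij ?in_fsetU ?tI ?orbT // => u; rewrite in_fsetU => ->.
  have lt_ij : (i < j)%N by rewrite ji.
  by move=> ti; have := I_incr lt_ij ti tI; rewrite ltxx.
split.
- by apply/fset0Pn; exists s; rewrite in_fsetU sI.
- by move=> u; rewrite in_fsetU => /orP[/iT|/jT].
- move=> u v w; rewrite !in_fsetU => u_ij w_ij vT /andP[le_uv le_vw].
  (* The run containing [v] has index between [i] and [j = i + 1], so it is one of these two. *)
  have [k vk] := sign_runs_cover vT.
  have le_ik : (i <= k)%N.
    rewrite leqNgt; apply/negP => lt_ki.
    move: le_uv; rewrite leNgt => /negP; apply.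
    by case/orP: u_ij => uI; apply: (I_incr _ vk uI) => //; lia.
  have le_kj : (k <= j)%N.
    rewrite leqNgt; apply/negP => lt_jk.
    move: le_vw; rewrite leNgt => /negP; apply.
    by case/orP: w_ij => wI; apply: (I_incr _ wI vk) => //; lia.
  have [/eqP eq_ki|neq_ki] := boolP (k == i); first by rewrite -eq_ki vk.
  suff -> : j = k by rewrite vk orbT.
  by apply/val_inj => /=; move: neq_ki; rewrite -val_eqE /=; lia.
- by move=> u v /sign_s su /sign_s sv; rewrite -/(sgq u) -/(sgq v) su.
Qed.

End SignRuns.

Lemma fset_extrema (R : realDomainType) (J : {fset R}) : (2 <= #|` J|%fset)%N ->
  exists a b, [/\ a \in J, b \in J, a < b & forall t, t \in J -> a <= t <= b].
Proof.
move=> J_card; have /fset0Pn[t0 t0J] : J != fset0.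
  by apply: contraTneq J_card => ->; rewrite cardfs0.
have [a _ a_min] :=
  @Order.TotalTheory.arg_minP _ _ _ [` t0J]%fset predT val isT.
have [b _ b_max] :=
  @Order.TotalTheory.arg_maxP _ _ _ [` t0J]%fset predT val isT.
have bound t : t \in J -> val a <= t <= val b.
  move=> tJ; apply/andP.
  by split; [exact: (a_min [` tJ]%fset isT)|exact: (b_max [` tJ]%fset isT)].
exists (val a), (val b); split; rewrite ?fsvalP //.
rewrite lt_neqAle (a_min b isT) andbT; apply: contraTneq J_card => eq_ab.
rewrite -leqNgt -(cardfs1 (val a)); apply: fsubset_leq_card.
apply/fsubsetP => t /bound; rewrite -eq_ab inE => /andP[le_at le_ta].
by apply/eqP/le_anti/andP.
Qed.

(** * Faces of the Veronese polytope *)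

Section VeroneseCrossLike.
Variables (R : realType) (d : nat) (T : {fset R}) (xi : 'rV[R]_d.+1).
Variables (J : nat -> {fset R}) (a b : nat -> R) (s : R).
Hypothesis d_gt0 : (0 < d)%N.
Hypothesis J_incr : forall i j s t,
  (i < j <= d)%N -> s \in J i -> t \in J j -> s < t.
Hypothesis aJ : forall i, (i <= d)%N -> a i \in J i.
Hypothesis bJ : forall i, (i <= d)%N -> b i \in J i.
Hypothesis lt_ab : forall i, (i <= d)%N -> a i < b i.
Hypothesis J_range : forall i t, (i <= d)%N -> t \in J i -> a i <= t <= b i.
Hypothesis JT : forall i t, (i <= d)%N -> t \in J i -> t \in T.
Hypothesis T_cover : forall t, t \in T -> exists2 i, (i <= d)%N & t \in J i.
Hypothesis q_sign : forall i t,
  (i <= d)%N -> t \in J i -> 0 < s * (-1) ^+ i * qform xi t.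

Let point t := (qform xi t)^-1 *: veronese d t.
(** An antipodal pair consists of the two ends facing each other across the gap between runs [j] and
    [j.+1]. *)
Let endpoint (x : 'I_d * bool) := if x.2 then a x.1.+1 else b x.1.

Let q_neq0 t : t \in T -> qform xi t != 0.
Proof.
move=> /T_cover[i le_id /(q_sign le_id)].
by apply: contraTneq => ->; rewrite mulr0 ltxx.
Qed.

Let s_neq0 : s != 0.
Proof.
have := q_sign (leq0n d) (aJ (leq0n d)).
by apply: contraTneq => ->; rewrite !mul0r ltxx.
Qed.

Let endpointT x : endpoint x \in T.
Proof.
have := ltn_ord x.1; rewrite /endpoint; case: x.2 => lt_xd.
  by apply: (@JT x.1.+1); rewrite ?aJ.
by apply: (@JT x.1); rewrite ?bJ // ltnW.
Qed.

Let point_horner t (c : 'cV[R]_d.+1) : (point t *m c) 0 0 =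
  (qform xi t)^-1 * (\poly_(i < d.+1) c (inord i) 0).[t].
Proof.
rewrite -scalemxAl mxE horner_poly mxE; congr (_ * _); apply: eq_bigr => i _.
by rewrite mxE inord_val mulrC.
Qed.

Lemma tight_dichotomy (c : 'cV[R]_d.+1) (e : R) :
  (forall t, t \in T -> (point t *m c) 0 0 <= e) ->
  (forall t, t \in T -> (point t *m c) 0 0 = e) \/
  antipode_free [set x | (point (endpoint x) *m c) 0 0 = e] /\
  (forall t, t \in T -> (point t *m c) 0 0 = e -> exists x, t = endpoint x).
Proof.
move=> T_le.
(* The numerator of the slack: [e] times the polynomial of [xi] minus that of [c]. *)
pose p : {poly R} := \poly_(i < d.+1) (e * xi 0 (inord i) - c (inord i) 0).
have slackE t : t \in T -> e - (point t *m c) 0 0 = (qform xi t)^-1 * p.[t].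
  move=> tT; rewrite point_horner !horner_poly.
  have -> : \sum_(i < d.+1) (e * xi 0 (inord i) - c (inord i) 0) * t ^+ i =
      e * qform xi t - \sum_(i < d.+1) c (inord i) 0 * t ^+ i.
    rewrite mulr_sumr -sumrB; apply: eq_bigr => i _.
    by rewrite inord_val mulrBl mulrA.
  by rewrite mulrBr mulrCA mulVf ?q_neq0 // mulr1.
have tight_root t : t \in T -> (point t *m c) 0 0 = e <-> root (s *: p) t.
  move=> tT; rewrite rootZ // rootE; split=> [eq_e|/eqP pt0].
    have := slackE t tT; rewrite eq_e subrr => /esym/eqP.
    by rewrite mulf_eq0 invr_eq0 (negbTE (q_neq0 tT)).
  by apply/esym/eqP; rewrite -subr_eq0 slackE // pt0 mulr0.
have [p0|sp_neq0] := eqVneq (s *: p) 0.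
  by left=> t tT; apply/tight_root => //; rewrite p0 root0.
right.
have size_sp : (size (s *: p) <= d.+1)%N.
  by apply: leq_trans (size_scale_leq _ _) _; exact: size_poly.
have sp_sign i t : (i <= d)%N -> t \in J i -> 0 <= (-1) ^+ i * (s *: p).[t].
  move=> le_id tJ; have tT := JT le_id tJ.
  (* The nonnegative slack times the positive quantity of [q_sign]. *)
  have -> : (-1) ^+ i * (s *: p).[t] =
      (qform xi t)^-1 * p.[t] * (s * (-1) ^+ i * qform xi t).
    by rewrite hornerZ; have := q_neq0 tT => q0; field.
  rewrite mulr_ge0 //; last exact/ltW/q_sign.
  by rewrite -slackE // subr_ge0 T_le.
split=> [i [/= /tight_root root_t /tight_root root_f]|t tT /tight_root root_t].
  apply: (adjacent_endpoints_not_roots J_incr aJ bJ lt_ab sp_neq0 size_sp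
    sp_sign (ltn_ord i)).
    by apply: root_f; exact: (endpointT (i, false)).
  by apply: root_t; exact: (endpointT (i, true)).
have [j le_jd tJ] := T_cover tT.
have [[-> lt_jd]|[-> j_gt0]] := root_in_run_endpoint J_incr aJ bJ lt_ab J_range
    sp_neq0 size_sp sp_sign le_jd tJ (root_t tT).
  by exists (Ordinal lt_jd, false).
have lt_jd : (j.-1 < d)%N by rewrite prednK.
by exists (Ordinal lt_jd, true); rewrite /endpoint /= prednK.
Qed.

Lemma tight_realization (A : set ('I_d * bool)) : antipode_free A ->
  exists (c : 'cV[R]_d.+1),
    (forall t, t \in T -> (point t *m c) 0 0 <= 0) /\
    [set x | (point (endpoint x) *m c) 0 0 = 0] = A.
Proof.
move=> A_free.
have lt_ab2 i k : (i <= k <= d)%N -> a i < b k.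
  move=> /andP[le_ik le_kd]; move: le_ik.
  rewrite leq_eqVlt => /orP[/eqP ->|lt_ik].
    exact: lt_ab.
  by apply: (@J_incr i k); rewrite ?aJ ?bJ ?lt_ik //; lia.
have lt_ba i k : (i < k <= d)%N -> b i < a k.
  by move=> lt_ik; apply: (J_incr lt_ik); rewrite ?aJ ?bJ //; lia.
(* One root per closed gap: the end selected by [A], or the midpoint, which is neither end, if [A]
   selects none. *)
pose r0 (j : 'I_d) := if `[< A (j, true) >] then a j.+1
  else if `[< A (j, false) >] then b j else (b j + a j.+1) / 2.
have lt_gap (j : 'I_d) : b j < a j.+1 by apply: lt_ba; rewrite ltnSn ltn_ord.
have r0_bounds (j : 'I_d) : b j <= r0 j <= a j.+1.
  have := lt_gap j; rewrite /r0.
  by case: asboolP => _; first lra; case: asboolP => _; lra.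
have r0_true (j : 'I_d) : r0 j = a j.+1 <-> A (j, true).
  have := lt_gap j; rewrite /r0; case: asboolP => // nA.
  by case: asboolP => _ lt_j; split=> // eq_r; exfalso; lra.
have r0_false (j : 'I_d) : r0 j = b j <-> A (j, false).
  have := lt_gap j; have := A_free j; rewrite /r0; case: asboolP => AT.
    by move=> nAF lt_j; split=> [eq_r|AF]; exfalso; [lra|apply: nAF].
  by case: asboolP => // nAF _ lt_j; split=> // eq_r; exfalso; lra.
pose r k := r0 (insubd (Ordinal d_gt0) k).
have rE (j : 'I_d) : r j = r0 j by rewrite /r valKd.
have r_bounds j : (j < d)%N -> b j <= r j <= a j.+1.
  move=> lt_jd; rewrite (rE (Ordinal lt_jd)).
  exact: (r0_bounds (Ordinal lt_jd)).
pose g : {poly R} := \prod_(k < d) ('X - (r k)%:P).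
(* On run [k] the product [g] has weak sign [(-1) ^+ (d - k)], so this factor gives [p] the sign of
   [qform xi]. *)
pose p := (s * (-1) ^+ d) *: g.
have size_p : (size p <= d.+1)%N.
  apply: leq_trans (size_scale_leq _ _) _.
  by rewrite /g size_prod_XsubC /index_enum -enumT size_enum_ord.
(* The minus sign turns [p / q >= 0] into a functional bounded above by 0. *)
pose c : 'cV[R]_d.+1 := \col_i - p`_i.
have pointE t : (point t *m c) 0 0 = - ((qform xi t)^-1 * p.[t]).
  rewrite point_horner -mulrN -hornerN; congr (_ * _.[t]); apply/polyP => i.
  rewrite coef_poly coefN; case: ltnP => [lt_i|le_i].
    by rewrite mxE inordK.
  by rewrite nth_default ?oppr0 // (leq_trans size_p).
have root_g t : t \in T -> (point t *m c) 0 0 = 0 <-> exists j : 'I_d, t = r0 j.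
  move=> tT.
  have s'_neq0 : s * (-1) ^+ d != 0 by rewrite mulf_neq0 ?signr_eq0.
  rewrite pointE; split=> [/eqP|[j ->]].
    rewrite oppr_eq0 mulf_eq0 invr_eq0 (negbTE (q_neq0 tT)) /= -rootE rootZ //.
    rewrite rootE /g horner_prod => /eqP/eqP/prodf_eq0[j _].
    by rewrite hornerXsubC subr_eq0 rE => /eqP ->; exists j.
  rewrite /p hornerZ /g horner_prod (bigD1 j) //= hornerXsubC rE subrr.
  by rewrite mul0r !mulr0 oppr0.
exists c; split=> [t tT|].
  rewrite pointE oppr_le0.
  have [k le_kd tJ] := T_cover tT; have := q_sign le_kd tJ.
  set x := s * _; move=> xq_gt0.
  have -> : (qform xi t)^-1 * p.[t] =
      (x * qform xi t)^-1 * (s * s * ((-1) ^+ (d - k) * g.[t])).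
    rewrite hornerZ /x; have := q_neq0 tT => q0.
    have -> : (-1) ^+ d = (-1) ^+ (d - k) * (-1) ^+ k :> R.
      by rewrite -exprD subnK.
    have : (-1) ^+ k * (-1) ^+ k = 1 :> R by rewrite -expr2 sqrr_sign.
    have : (-1) ^+ k != 0 :> R by rewrite signr_eq0.
    move: ((-1) ^+ k) ((-1) ^+ (d - k)) => y z y0 yy.
    have -> : s * (z * y) * g.[t] = s * z * g.[t] * (y * y) / y by field.
    by rewrite yy; field; rewrite s_neq0 q0 y0.
  apply: mulr_ge0; first by rewrite invr_ge0 ltW.
  apply: mulr_ge0; first by rewrite -expr2 sqr_ge0.
  rewrite /g horner_prod; under eq_bigr do rewrite hornerXsubC.
  have [le_at le_tb] := andP (J_range le_kd tJ).
  (* The switch is at [k]: roots in earlier gaps are at most [a k], the others at least [b k]. *)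
  apply: (@sign_prod_switch _ d k (fun i => t - r i)) => // i.
    move=> lt_ik; have /r_bounds/andP[_ le_ra] : (i < d)%N by lia.
    rewrite subr_ge0 (le_trans le_ra) //; apply: le_trans le_at.
    move: lt_ik; rewrite leq_eqVlt => /orP[/eqP -> //|lt_ik].
    by apply/ltW/(J_incr (i := i.+1) (j := k)); rewrite ?aJ //; lia.
  move=> /andP[le_ki lt_id]; have /andP[le_br _] := r_bounds _ lt_id.
  rewrite subr_le0 (le_trans le_tb) //; apply: le_trans le_br.
  move: le_ki; rewrite leq_eqVlt => /orP[/eqP -> //|lt_ki].
  by apply/ltW/(J_incr (i := k) (j := i)); rewrite ?bJ //; lia.
(* Distinct closed gaps are disjoint, because [a i < b i] in the run between them. *)
have endpoint_root (j k : 'I_d) (u : bool) : endpoint (j, u) = r0 k -> j = k.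
  have /andP[le_br le_ra] := r0_bounds k; move=> eq_r; apply/val_inj/eqP.
  have lt_jd := ltn_ord j; have lt_kd := ltn_ord k.
  have [lt_jk|lt_kj|//] := ltngtP (j : nat) k; exfalso.
    have lt1 : a j.+1 < b k by apply: lt_ab2; lia.
    have lt2 := lt_gap j.
    by move: eq_r; rewrite /endpoint; case: u => /= eq_r; lra.
  have lt1 : a k.+1 < b j by apply: lt_ab2; lia.
  have lt2 := lt_gap j.
  by move: eq_r; rewrite /endpoint; case: u => /= eq_r; lra.
apply/seteqP; split=> -[j u] /=.
  move=> /(root_g _ (endpointT (j, u))) [k eq_r].
  have eq_jk := endpoint_root _ _ _ eq_r; move: eq_r; rewrite -eq_jk /endpoint.
  by case: u => /esym; [move/r0_true|move/r0_false].
move=> Aju; apply/(root_g _ (endpointT (j, u))); exists j; rewrite /endpoint /=.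
by case: u Aju; [move/r0_true|move/r0_false].
Qed.

Lemma veronese_cross_like :
  cross_like [set x | exists2 t, t \in T & x = (qform xi t)^-1 *: veronese d t]
    (fun x : 'I_d * bool => point (endpoint x)).
Proof.
split.
- by move=> x; exists (endpoint x); first exact: endpointT.
- move=> c e V_le.
  have [|all_tight|[free only]] := @tight_dichotomy c e.
  + by move=> t tT; apply: V_le; exists t.
  + by left=> x [t tT ->]; exact: all_tight.
  + right; split=> // x [t tT ->] /(only t tT)[y ->].
    by exists y.
- move=> A /tight_realization[c [c_le c_tight]]; exists c, 0; split=> //.
  by move=> x [t tT ->]; exact: c_le.
Qed.

End VeroneseCrossLike.

(** * Comparison with the cross-polytope *)

Lemma sgr_neq_opp (R : realDomainType) (x y : R) :
  x != 0 -> y != 0 -> Num.sg x != Num.sg y -> Num.sg y = - Num.sg x.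
Proof.
by case: (sgrP x) => //; case: (sgrP y) => //; rewrite ?opprK // eqxx.
Qed.

Theorem theorem3p17 (R : realType) (d n : nat) (hd : (3 <= d)%N)
    (T : {fset R}) (hT : #|` T|%fset = n) (hn : (d.+1 <= n)%N)
    (sigma : set 'rV[R]_d.+1) (hsigma : is_chamber T sigma)
    (I : 'I_d.+1 -> {fset R}) (hI : is_signed_decomposition T sigma I)
    (hcard : forall j : 'I_d.+1, (2 <= #|` I j|%fset)%N) :
  forall xi : 'rV[R]_d.+1, interior sigma xi ->
    combinatorially_equivalent (veronese_polytope T xi) (cross_polytope R d).
Proof.
move=> xi int_xi; have d_gt0 : (0 < d)%N by exact: leq_trans hd.
have [xi0 int_xi0 [I_runs I_incr]] := hI.
(* The decomposition is witnessed by [xi0]; its signs on [T] carry over to the given [xi]. *)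
have same_sign t : t \in T -> 0 < qform xi0 t * qform xi t.
  exact: chamber_sign hsigma int_xi0 int_xi.
(* Runs are indexed by natural numbers; beyond [d], [inord] falls back to a default index. *)
pose J k := I (inord k).
have I_T j t : t \in I j -> t \in T.
  have [[_ sub _ _] _] := (I_runs (I j)).2 (ex_intro _ j erefl).
  exact: sub.
have I_sign j s t : s \in I j -> t \in I j ->
    Num.sg (qform xi0 s) = Num.sg (qform xi0 t).
  have [[_ _ _ sign] _] := (I_runs (I j)).2 (ex_intro _ j erefl).
  exact: sign.
have /choice[a /choice[b ab]] k := fset_extrema (hcard (inord k)).
have aJ k : a k \in J k by have [] := ab k.
have bJ k : b k \in J k by have [] := ab k.
have lt_ab k : a k < b k by have [] := ab k.
have J_range k t : t \in J k -> a k <= t <= b k.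
  by have [_ _ _ bounds] := ab k; exact: bounds.
have J_T k t : t \in J k -> t \in T by exact: I_T.
have J_incr i j s t : (i < j <= d)%N -> s \in J i -> t \in J j -> s < t.
  by move=> lt_ij; apply: I_incr; rewrite !inordK //; lia.
have T_cover t : t \in T -> exists2 k, (k <= d)%N & t \in J k.
  move=> /(sign_runs_cover I_runs)[j tj].
  by exists j; [rewrite -ltnS|rewrite /J inord_val].
have q0_neq0 t : t \in T -> qform xi0 t != 0.
  by move=> /same_sign; apply: contraTneq => ->; rewrite mul0r ltxx.
pose s := Num.sg (qform xi0 (a 0%N)).
have sgE k t : (k <= d)%N -> t \in J k -> Num.sg (qform xi0 t) = s * (-1) ^+ k.
  elim: k t => [|k IHk] t le_kd tJ.
    by rewrite expr0 mulr1; apply: I_sign tJ (aJ 0%N).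
  have le_kd' : (k <= d)%N by exact: ltnW.
  have : Num.sg (qform xi0 (a k)) != Num.sg (qform xi0 t).
    apply: (sign_runs_switch I_runs I_incr
      (i := inord k) (j := inord k.+1)) => //.
    by rewrite !inordK.
  rewrite exprS mulN1r mulrN -(IHk _ le_kd' (aJ k)).
  have := q0_neq0 _ (J_T _ _ tJ); have := q0_neq0 _ (J_T _ _ (aJ k)).
  by move=> *; apply: sgr_neq_opp.
have q_sign k t : (k <= d)%N -> t \in J k -> 0 < s * (-1) ^+ k * qform xi t.
  move=> le_kd tJ; have tT := J_T _ _ tJ.
  rewrite -(sgE k t le_kd tJ).
  (* Multiplying by this square splits the product into the absolute value of [qform xi0 t] and the
     positive product of [same_sign]. *)
  rewrite -(@pmulr_lgt0 _ (qform xi0 t ^+ 2)) ?exprn_even_gt0 ?q0_neq0 //.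
  have -> : Num.sg (qform xi0 t) * qform xi t * qform xi0 t ^+ 2 =
      (qform xi0 t * Num.sg (qform xi0 t)) * (qform xi0 t * qform xi t) by ring.
  by rewrite mulr_gt0 ?same_sign // mulrC -normrEsg normr_gt0 q0_neq0.
apply: (cross_like_equivalent d_gt0) (cross_polytope_cross_like R d_gt0).
exact: (veronese_cross_like d_gt0 J_incr (fun k _ => aJ k) (fun k _ => bJ k)
  (fun k _ => lt_ab k) (fun k t _ => J_range k t) (fun k t _ => J_T k t)
  T_cover q_sign).
Qed.
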